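(* For $\gamma\in\mathbb{R}\setminus\{0\}$ let $L_6^\gamma$ be the 6-dimensional real Lie algebra with basis $(e_1,\ldots,e_6)$ and non-zero brackets $$[e_1,e_3]=e_5,\quad [e_1,e_4]=e_6,\quad [e_2,e_3]=\gamma e_6,\quad [e_2,e_4]=e_5 .$$ Then: if $\gamma>0$, $L_6^\gamma\cong\mathfrak{h}_3\oplus\mathfrak{h}_3$ (so $L_6^\gamma$ is decomposable); if $\gamma<0$, $L_6^\gamma\cong L_6^{-1}$; and $L_6^{\gamma}\not\cong L_6^{-1}$ for every $\gamma>0$.
   Context: $\mathfrak{h}_3=\mathrm{Span}\{X,Y,Z\}$ is the 3-dimensional real Heisenberg Lie algebra with only non-zero bracket $[X,Y]=Z$ (up to antisymmetry). A Lie algebra is decomposable if it is the (Lie algebra) direct sum of two non-trivial subalgebras. All brackets of basis vectors not listed (and not following by antisymmetry) are zero. *)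

(* Defs.v *)
From HB Require Import structures.
From mathcomp Require Import all_boot all_order all_algebra.
From mathcomp Require Import reals.

Set Implicit Arguments.
Unset Strict Implicit.
Unset Printing Implicit Defensive.

Import GRing.Theory.
Local Open Scope ring_scope.

(* Finite-dimensional Lie algebras over a field F; the bracket of x and y is
   written lie x y. *)
HB.mixin Record Vector_isLieAlgebra (F : fieldType) L of Vector F L := {
  lie : L -> L -> L;
  lie_linearl : forall y : L, linear (lie^~ y);
  lie_linearr : forall x : L, linear (lie x);
  liexx : forall x : L, lie x x = 0;
  lie_jacobi : forall x y z : L,
    lie x (lie y z) + lie y (lie z x) + lie z (lie x y) = 0
}.

#[short(type="lieAlgType")]
HB.structure Definition LieAlgebra (F : fieldType) :=
  { L of Vector F L & Vector_isLieAlgebra F L }.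

Arguments lie {F s} x y : rename.

Definition lie_isomorphic (F : fieldType) (L M : lieAlgType F) : Prop :=
  exists f : {linear L -> M},
    bijective f /\ {morph f : x y / lie x y >-> lie x y}.

Definition lie_subalgebra (F : fieldType) (L : lieAlgType F)
    (U : {vspace L}) : Prop :=
  {in U &, forall x y, lie x y \in U}.

Definition lie_decomposable (F : fieldType) (L : lieAlgType F) : Prop :=
  exists U V : {vspace L},
    [/\ lie_subalgebra U /\ lie_subalgebra V,
        U != 0%VS /\ V != 0%VS,
        (U + V)%VS = fullv /\ (U :&: V)%VS = 0%VS
      & {in U & V, forall x y, lie x y = 0}].

(* The external direct sum: componentwise bracket on the product space. *)
Section DirectSum.
Variables (F : fieldType) (L M : lieAlgType F).

Definition lie_pair (x y : L * M) : L * M := (lie x.1 y.1, lie x.2 y.2).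

Fact lie_pair_linearl y : linear (lie_pair^~ y).
Proof.
by move=> a u v; congr pair; rewrite /= lie_linearl.
Qed.

Fact lie_pair_linearr x : linear (lie_pair x).
Proof.
by move=> a u v; congr pair; rewrite /= lie_linearr.
Qed.

Fact lie_pairxx x : lie_pair x x = 0.
Proof. by rewrite /lie_pair !liexx. Qed.

Fact lie_pair_jacobi x y z :
  lie_pair x (lie_pair y z) + lie_pair y (lie_pair z x)
    + lie_pair z (lie_pair x y) = 0.
Proof. by congr pair; rewrite /= lie_jacobi. Qed.

HB.instance Definition _ := Vector_isLieAlgebra.Build F (L * M)%type
  lie_pair_linearl lie_pair_linearr lie_pairxx lie_pair_jacobi.

End DirectSum.

(* Basis vectors are numbered from 1: e_ k is the k-th vector of the standard
   basis of F^n.+1, for 1 <= k <= n.+1. *)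
Definition e_ (F : fieldType) (n k : nat) : 'rV[F]_n.+1 :=
  delta_mx 0 (inord k.-1).
Arguments e_ {F n} k.

Lemma e_E (F : fieldType) (n k : nat) (j : 'I_n.+1) :
  (0 < k <= n.+1)%N -> (e_ k : 'rV[F]_n.+1) 0 j = (j.+1 == k)%:R.
Proof.
by case: k => // k /= ltk; rewrite mxE eqxx -(inj_eq val_inj) /= inordK.
Qed.

(* The alternating bilinear map determined by a table c of brackets of basis
   vectors (indexed by nat from 1, as above), in which each unordered pair is
   listed at most once: [e_i, e_j] = c i j - c j i. *)
Section Table.
Variables (F : fieldType) (n : nat) (c : nat -> nat -> 'rV[F]_n.+1).

Definition table_lie (x y : 'rV[F]_n.+1) : 'rV[F]_n.+1 :=
  \sum_i \sum_j (x 0 i * y 0 j - x 0 j * y 0 i) *: c i.+1 j.+1.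

Fact table_lie_linearl y : linear (table_lie^~ y).
Proof.
move=> a u v; rewrite /table_lie scaler_sumr -big_split /=.
apply: eq_bigr => i _; rewrite scaler_sumr -big_split /=.
apply: eq_bigr => j _; rewrite !mxE scalerA -scalerDl; congr (_ *: _).
by rewrite !mulrDl mulrBr opprD addrACA !mulrA.
Qed.

Fact table_liexx x : table_lie x x = 0.
Proof.
by apply: big1 => i _; apply: big1 => j _; rewrite mulrC subrr scale0r.
Qed.

Fact table_lieC x y : table_lie x y = - table_lie y x.
Proof.
rewrite /table_lie -sumrN; apply: eq_bigr => i _.
rewrite -sumrN; apply: eq_bigr => j _; rewrite -scaleNr opprB.
by rewrite [y 0 j * _]mulrC [y 0 i * _]mulrC.
Qed.

Fact table_lie_linearr x : linear (table_lie x).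
Proof.
move=> a u v; rewrite !(table_lieC x) (table_lie_linearl x) opprD.
by rewrite scalerN.
Qed.

Lemma table_lie_basis (i j : nat) : (0 < i <= n.+1)%N -> (0 < j <= n.+1)%N ->
  table_lie (e_ i) (e_ j) = c i j - c j i.
Proof.
case: i j => // i [|j] //= lti ltj; rewrite /table_lie /e_ /=.
under eq_bigr => k _ do under eq_bigr => l _ do
  rewrite !mxE eqxx /= -!natrM !mulnb scalerBl.
under eq_bigr => k _ do rewrite sumrB.
rewrite sumrB; congr (_ - _).
  rewrite (bigD1 (inord i)) //= (bigD1 (inord j)) //= !eqxx scale1r !inordK //.
  rewrite !big1 ?addr0 // => k /negPf ki; last by rewrite ki scale0r.
  by rewrite big1 // => l _; rewrite ki scale0r.
rewrite (bigD1 (inord j)) //= (bigD1 (inord i)) //= !eqxx scale1r !inordK //.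
rewrite !big1 ?addr0 // => k /negPf ki; last by rewrite ki scale0r.
by rewrite big1 // => l _; rewrite ki andbF scale0r.
Qed.

(* Jacobi for a 2-step table: brackets of basis vectors are supported on
   basis vectors that have no bracket themselves. *)
Fact table_lie_jacobi :
  (forall i j k l : 'I_n.+1,
     c i.+1 j.+1 0 k = 0 \/ c k.+1 l.+1 = 0 /\ c l.+1 k.+1 = 0) ->
  forall x y z, table_lie x (table_lie y z) + table_lie y (table_lie z x)
    + table_lie z (table_lie x y) = 0.
Proof.
move=> c2; suff c3 x y z : table_lie x (table_lie y z) = 0.
  by move=> x y z; rewrite !c3 !addr0.
have yz0 (k l : 'I_n.+1) : (table_lie y z) 0 k = 0 \/ c k.+1 l.+1 = 0 /\ c l.+1 k.+1 = 0.
  have [ckl|ckl] := eqVneq (c k.+1 l.+1) 0; last first.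
    left; rewrite summxE big1 // => i _; rewrite summxE big1 // => j _.
    rewrite mxE; case: (c2 i j k l) => [->|[ckl0]]; first by rewrite mulr0.
    by rewrite ckl0 eqxx in ckl.
  have [clk|clk] := eqVneq (c l.+1 k.+1) 0; first by right.
  left; rewrite summxE big1 // => i _; rewrite summxE big1 // => j _.
  rewrite mxE; case: (c2 i j k l) => [->|[_ clk0]]; first by rewrite mulr0.
  by rewrite clk0 eqxx in clk.
rewrite {1}/table_lie; apply: big1 => i _; apply: big1 => j _.
rewrite scalerBl.
have [->|[_ ->]] := yz0 j i; last by rewrite !scaler0 subrr.
have [->|[-> _]] := yz0 i j; last by rewrite !scaler0 subrr.
by rewrite !mulr0 !scale0r subrr.
Qed.

End Table.

(* The Heisenberg algebra, with (X, Y, Z) = (e_ 1, e_ 2, e_ 3). *)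
Section Heisenberg.
Variable F : fieldType.

Definition h3_table (i j : nat) : 'rV[F]_3 :=
  match i, j with
  | 1%N, 2%N => e_ 3
  | _, _ => 0
  end.

Definition h3 : Type := 'rV[F]_3.

Fact h3_jacobi (x y z : 'rV[F]_3) :
  let br := table_lie h3_table in
  br x (br y z) + br y (br z x) + br z (br x y) = 0.
Proof.
have c3 (i j : nat) (k : 'I_3) : (k < 2)%N -> h3_table i j 0 k = 0.
  move=> ltk; move: i j => [|[|i]] [|[|[|j]]];
    by rewrite /= ?e_E ?eqSS ?ltn_eqF // mxE.
apply: table_lie_jacobi => i j k l.
have [/c3 -> | le2k] := ltnP k 2; [by left | right].
by case: k le2k => -[|[|[|k]]] //= _ _; case: (val l) => [|[|?]].
Qed.

HB.instance Definition _ := Vector.on h3.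
HB.instance Definition _ := Vector_isLieAlgebra.Build F h3
  (table_lie_linearl h3_table) (table_lie_linearr h3_table)
  (table_liexx h3_table) h3_jacobi.

Lemma h3_lieE (i j : nat) : (0 < i <= 3)%N -> (0 < j <= 3)%N ->
  lie (e_ i : h3) (e_ j : h3) = h3_table i j - h3_table j i.
Proof. exact: table_lie_basis. Qed.

End Heisenberg.

(* The parameter g only selects the bracket, given by the table below. *)
Definition L6 (F : fieldType) (g : F) : Type := 'rV[F]_6.

Section L6.
Variables (F : fieldType) (g : F).

Definition L6_table (i j : nat) : 'rV[F]_6 :=
  match i, j with
  | 1%N, 3%N => e_ 5
  | 1%N, 4%N => e_ 6
  | 2%N, 3%N => g *: e_ 6
  | 2%N, 4%N => e_ 5
  | _, _ => 0
  end.

Fact L6_jacobi (x y z : 'rV[F]_6) :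
  let br := table_lie L6_table in
  br x (br y z) + br y (br z x) + br z (br x y) = 0.
Proof.
have c56 (i j : nat) (k : 'I_6) : (k < 4)%N -> L6_table i j 0 k = 0.
  move=> ltk; have ltk5 : (k < 5)%N by apply: ltnW.
  move: i j => [|[|[|i]]] [|[|[|[|[|j]]]]];
    by rewrite /= ?[(g *: e_ _) _ _]mxE ?e_E ?eqSS ?ltn_eqF ?mulr0 // mxE.
apply: table_lie_jacobi => i j k l.
have [/c56 -> | le4k] := ltnP k 4; [by left | right].
by case: k le4k => -[|[|[|[|k]]]] //= _ _; case: (val l) => [|[|?]].
Qed.

HB.instance Definition _ := Vector.on (L6 g).
HB.instance Definition _ := Vector_isLieAlgebra.Build F (L6 g)
  (table_lie_linearl L6_table) (table_lie_linearr L6_table)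
  (table_liexx L6_table) L6_jacobi.

Lemma L6_lieE (i j : nat) : (0 < i <= 6)%N -> (0 < j <= 6)%N ->
  lie (e_ i : L6 g) (e_ j : L6 g) = L6_table i j - L6_table j i.
Proof. exact: table_lie_basis. Qed.

End L6.

(* Main.v *)
From HB Require Import structures.
Require Import Defs.
From mathcomp Require Import all_boot all_order all_algebra.
From mathcomp Require Import reals.
From mathcomp Require Import ring lra.

Set Implicit Arguments.
Unset Strict Implicit.
Unset Printing Implicit Defensive.

Import GRing.Theory.
Local Open Scope ring_scope.

(** If [gamma = s^2], the bracket 2-forms [w5 = x1^x3 + x2^x4] and
    [w6 = x1^x4 + gamma x2^x3] satisfy
    [w6 + t w5 = (x1 + t x2) ^ (x4 + t x3)] for [t = s] and [t = - s], so these
    two combinations split the algebra into two Heisenberg algebras.  Rescaling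
    [e2], [e3] and [e5] multiplies [gamma] by a nonzero square.  Finally,
    [L6 gamma] has an element [x] with [ad x] of rank one if and only if [gamma]
    is a square, and this property is invariant under isomorphism. *)

(* Coordinates are numbered from 1, like the basis vectors [e_ k]. *)
Definition coef (F : fieldType) (n : nat) (x : 'rV[F]_n.+1) (k : nat) : F :=
  x 0 (inord k.-1).
Arguments coef {F n} x k.

(** Entries past the end of the list default to zero, so a short list is padded: [rvec 5 [:: t; 1]]
    is [t e1 + e2]. *)
Definition rvec (F : fieldType) (n : nat) (s : seq F) : 'rV[F]_n.+1 :=
  \row_i s`_i.
Arguments rvec {F} n s.

Section Coordinates.
Variables (F : fieldType) (n : nat).
Implicit Types x y : 'rV[F]_n.+1.

Lemma coefP x y : (forall k, (k < n.+1)%N -> coef x k.+1 = coef y k.+1) -> x = y.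
Proof.
move=> eqxy; apply/rowP => i.
by have := eqxy i (ltn_ord i); rewrite /coef /= inord_val.
Qed.

Lemma coefD x y k : coef (x + y) k = coef x k + coef y k.
Proof. exact: mxE. Qed.

Lemma coefZ a x k : coef (a *: x) k = a * coef x k.
Proof. exact: mxE. Qed.

Lemma coef_rvec (s : seq F) k : (k < n.+1)%N -> coef (rvec n s) k.+1 = s`_k.
Proof. by move=> ltk; rewrite /coef mxE /= inordK. Qed.

Lemma coef_e_ i k : (i < n.+1)%N -> (k < n.+1)%N ->
  coef (e_ i.+1 : 'rV[F]_n.+1) k.+1 = (k == i)%:R.
Proof. by move=> lti ltk; rewrite /coef e_E //= inordK. Qed.

Lemma table_lie_coef (c : nat -> nat -> 'rV[F]_n.+1) x y :
  table_lie c x y = \sum_(i < n.+1) \sum_(j < n.+1)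
    (coef x i.+1 * coef y j.+1 - coef x j.+1 * coef y i.+1) *: c i.+1 j.+1.
Proof.
apply: eq_bigr => i _; apply: eq_bigr => j _.
by rewrite /coef /= !inord_val.
Qed.

End Coordinates.

Lemma h3_lie_coef (F : fieldType) (x y : h3 F) :
  lie x y = rvec 2 [:: 0; 0; coef x 1 * coef y 2 - coef x 2 * coef y 1].
Proof.
rewrite [LHS]table_lie_coef !big_ord_recl !big_ord0 /= /bump /=.
rewrite !scaler0 !addr0 !add0r.
apply: coefP => -[|[|[|k]]] // _;
  by rewrite coef_rvec // coefZ coef_e_ //= ?mulr0 ?mulr1.
Qed.

(** The last two entries are [w5] and [w6]; with them, bracket identities become polynomial
    identities in coordinates. *)
Lemma L6_lie_coef (F : fieldType) (g : F) (x y : L6 g) :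
  lie x y = rvec 5 [:: 0; 0; 0; 0;
    coef x 1 * coef y 3 - coef x 3 * coef y 1
      + (coef x 2 * coef y 4 - coef x 4 * coef y 2);
    coef x 1 * coef y 4 - coef x 4 * coef y 1
      + g * (coef x 2 * coef y 3 - coef x 3 * coef y 2)].
Proof.
rewrite [LHS]table_lie_coef !big_ord_recl !big_ord0 /= /bump /=.
rewrite !scaler0 !addr0 !add0r.
apply: coefP => -[|[|[|[|[|[|k]]]]]] // _;
  by rewrite coef_rvec // !(coefD, coefZ, coef_e_) //=; ring.
Qed.

Lemma L6_square_iso (F : fieldType) (s : F) : 2 != 0 :> F -> s != 0 ->
  lie_isomorphic (L6 (s ^+ 2)) (h3 F * h3 F)%type.
Proof.
move=> two_neq0 s_neq0.
pose half (t : F) (x : L6 (s ^+ 2)) : h3 F :=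
  rvec 2 [:: coef x 1 + t * coef x 2; coef x 4 + t * coef x 3;
             coef x 6 + t * coef x 5].
pose f x : (h3 F * h3 F)%type := (half s x, half (- s) x).
have half_linear t : linear (half t).
  move=> a x y; apply: coefP => -[|[|[|k]]] // _;
    by rewrite !(coefD, coefZ, coef_rvec) //=; ring.
have f_linear : linear f.
  by move=> a x y; congr pair; rewrite half_linear.
pose fL : {linear L6 (s ^+ 2) -> (h3 F * h3 F)%type} :=
  HB.pack f (GRing.isLinear.Build _ _ _ _ f f_linear).
exists fL; split.
  (* Each pair of coordinates is recovered from the values at [s] and [- s], by half their sum and
     by their difference over [2 * s]. *)
  pose g (p : (h3 F * h3 F)%type) : L6 (s ^+ 2) :=
    let: (a, b) := p in
    rvec 5 [:: (coef a 1 + coef b 1) / 2; (coef a 1 - coef b 1) / (2 * s);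
               (coef a 2 - coef b 2) / (2 * s); (coef a 2 + coef b 2) / 2;
               (coef a 3 - coef b 3) / (2 * s); (coef a 3 + coef b 3) / 2].
  exists g => [x | [a b]].
    apply: coefP => -[|[|[|[|[|[|k]]]]]] // _;
      rewrite !coef_rvec //=; field; by rewrite ?two_neq0 ?s_neq0.
  congr pair; apply: coefP => -[|[|[|k]]] // _;
    rewrite !coef_rvec //=; field; by rewrite ?two_neq0 ?s_neq0.
have half_lie t : t ^+ 2 = s ^+ 2 -> {morph half t : x y / lie x y}.
  move=> t2 x y; rewrite L6_lie_coef h3_lie_coef.
  apply: coefP => -[|[|[|k]]] // _; rewrite !coef_rvec //= -?t2; ring.
by move=> x y; congr pair; apply: half_lie; rewrite ?sqrrN.
Qed.

Lemma L6_scale_iso (F : fieldType) (c g : F) : c != 0 ->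
  lie_isomorphic (L6 (c ^+ 2 * g)) (L6 g).
Proof.
move=> c_neq0.
(* The weights fit the brackets: [[e1, e3]] and [[e2, e4]] both scale by [c], as [e5] does;
   [[e1, e4]] and [e6] are fixed; [[e2, e3]] gains [c ^+ 2], absorbed by the parameter. Source and
   target parameters are left free so that [c^-1] gives the inverse. *)
pose d (h h' c : F) (x : L6 h) : L6 h' :=
  rvec 5 [:: coef x 1; c * coef x 2; c * coef x 3; coef x 4; c * coef x 5;
             coef x 6].
pose f := d (c ^+ 2 * g) g c.
have f_linear : linear f.
  move=> a x y; apply: coefP => -[|[|[|[|[|[|k]]]]]] // _;
    by rewrite !(coefD, coefZ, coef_rvec) //=; ring.
pose fL : {linear L6 (c ^+ 2 * g) -> L6 g} :=
  HB.pack f (GRing.isLinear.Build _ _ _ _ f f_linear).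
exists fL; split.
  exists (d g (c ^+ 2 * g) c^-1) => x;
    apply: coefP => -[|[|[|[|[|[|k]]]]]] // _; rewrite !coef_rvec //=;
    by rewrite ?mulKf ?mulVKf.
move=> x y; rewrite /= !L6_lie_coef.
by apply: coefP => -[|[|[|[|[|[|k]]]]]] // _; rewrite !coef_rvec //=; ring.
Qed.

(** The summands are the preimages of the two factors, each the kernel of the other component of
    [f]; [m] and [n] witness that they are nonzero. *)
Lemma lie_isomorphic_prod_decomposable (F : fieldType) (L M N : lieAlgType F)
    (m : M) (n : N) :
  m != 0 -> n != 0 -> lie_isomorphic L (M * N)%type -> lie_decomposable L.
Proof.
move=> m_neq0 n_neq0 [f [[g fK gK] fM]].
pose f1 : 'Hom(L, M) := linfun (fst \o f).
pose f2 : 'Hom(L, N) := linfun (snd \o f).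
have f1E x : f1 x = (f x).1 by rewrite lfunE.
have f2E x : f2 x = (f x).2 by rewrite lfunE.
have lie0 (K : lieAlgType F) (x : K) : lie 0 x = 0.
  by have := lie_linearl x (-1) 0 0; rewrite scaler0 addr0 scaleN1r addNr.
have lier0 (K : lieAlgType F) (x : K) : lie x 0 = 0.
  by have := lie_linearr x (-1) 0 0; rewrite scaler0 addr0 scaleN1r addNr.
exists (lker f2), (lker f1); split.
- split=> x y; rewrite !memv_ker ?f1E ?f2E => /eqP x0 _;
    by rewrite fM /= x0 lie0.
- split; apply/eqP => ker0.
    have: g (m, 0) \in lker f2 by rewrite memv_ker f2E gK.
    rewrite ker0 memv0 => /eqP gm; case/eqP: m_neq0.
    by have := congr1 fst (gK (m, 0)); rewrite gm raddf0.
  have: g (0, n) \in lker f1 by rewrite memv_ker f1E gK.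
  rewrite ker0 memv0 => /eqP gn; case/eqP: n_neq0.
  by have := congr1 snd (gK (0, n)); rewrite gn raddf0.
- split; apply/eqP; rewrite ?eqEsubv ?subvf ?sub0v /= ?andbT.
    apply/subvP => x _.
    have -> : x = g ((f x).1, 0) + g (0, (f x).2).
      apply: (can_inj fK); rewrite linearD !gK.
      by rewrite [LHS]surjective_pairing; congr pair; rewrite ?addr0 ?add0r.
    by apply: memv_add; rewrite memv_ker ?f1E ?f2E gK.
  apply/subvP => x; rewrite memv_cap !memv_ker f1E f2E memv0.
  case/andP=> /eqP x2 /eqP x1; apply/eqP/(can_inj fK).
  by rewrite raddf0 [LHS]surjective_pairing x1 x2.
move=> x y; rewrite !memv_ker f1E f2E => /eqP x2 /eqP y1.
apply: (can_inj fK); rewrite fM raddf0 /= [LHS]surjective_pairing /=.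
by rewrite x2 y1 lie0 lier0.
Qed.

(** The image of [ad x] is the line through [lie x y]; in this form the property transports directly
    along an isomorphism. *)
Definition has_rank_one_ad (F : fieldType) (L : lieAlgType F) : Prop :=
  exists x y : L, lie x y <> 0 /\ forall z, exists a, lie x z = a *: lie x y.

Lemma lie_isomorphic_rank_one_ad (F : fieldType) (L M : lieAlgType F) :
  lie_isomorphic L M -> has_rank_one_ad L -> has_rank_one_ad M.
Proof.
move=> [f [[g fK gK] fM]] [x [y [xy_neq0 xyP]]].
exists (f x), (f y); split=> [|z].
  by rewrite -fM -[0 in X in _ = X](raddf0 f) => /(can_inj fK).
have [a xz] := xyP (g z); exists a.
by rewrite -[z]gK -!fM xz linearZ.
Qed.

Lemma L6_rank_one_ad (F : fieldType) (g : F) :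
  has_rank_one_ad (L6 g) <-> exists t, g = t ^+ 2.
Proof.
split=> [[x [y [xy_neq0 xyP]]] | [t ->]].
  (* Brackets lie in the span of [e5] and [e6], so rank one makes every 2x2 minor of [ad x]
     vanish. *)
  have det0 u v : coef (lie x u) 5 * coef (lie x v) 6
                  = coef (lie x u) 6 * coef (lie x v) 5.
    have [a ->] := xyP u; have [b ->] := xyP v.
    by rewrite !coefZ; ring.
  have x12 := det0 (e_ 3) (e_ 4); have x34 := det0 (e_ 1) (e_ 2).
  rewrite !L6_lie_coef !coef_rvec //= !coef_e_ //= in x12 x34.
  have {}x12 : coef x 1 ^+ 2 = g * coef x 2 ^+ 2.
    by apply: etrans (etrans x12 _); ring.
  have {}x34 : coef x 4 ^+ 2 = g * coef x 3 ^+ 2.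
    by apply: etrans (etrans (esym x34) _); ring.
  have [x2|x2] := eqVneq (coef x 2) 0; last first.
    by exists (coef x 1 / coef x 2); rewrite expr_div_n x12 mulfK ?expf_neq0.
  have [x3|x3] := eqVneq (coef x 3) 0; last first.
    by exists (coef x 4 / coef x 3); rewrite expr_div_n x34 mulfK ?expf_neq0.
  (* With [x2 = x3 = 0] the minors force [x1 = x4 = 0], so [x] is central, contradicting
     [xy_neq0]. *)
  move/eqP: x12; rewrite x2 expr0n mulr0 sqrf_eq0 => /eqP x1.
  move/eqP: x34; rewrite x3 expr0n mulr0 sqrf_eq0 => /eqP x4.
  case: xy_neq0; rewrite L6_lie_coef x1 x2 x3 x4; apply: coefP => k ltk.
  rewrite coef_rvec // !mul0r !subrr mulr0 addr0 [RHS]mxE.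
  by move: k ltk => [|[|[|[|[|[|k]]]]]] //= _.
(* For [x = t e1 + e2], [[x, z] = (t z3 + z4) (e5 + t e6)], and [[x, e4] = e5 + t e6]. *)
exists (rvec 5 [:: t; 1] : L6 (t ^+ 2)), (e_ 4 : L6 (t ^+ 2)); split=> [xy0|z].
  have : coef (lie (rvec 5 [:: t; 1] : L6 (t ^+ 2)) (e_ 4)) 5 = 1.
    by rewrite L6_lie_coef !coef_rvec //= !coef_e_ //=; ring.
  by rewrite xy0 [LHS]mxE => /eqP; rewrite eq_sym oner_eq0.
exists (t * coef z 3 + coef z 4); rewrite !L6_lie_coef.
apply: coefP => -[|[|[|[|[|[|k]]]]]] // _;
  by rewrite !(coefZ, coef_rvec) //= ?coef_e_ //=; ring.
Qed.

Unset Implicit Arguments.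

Theorem mainTheorem3 (R : realType) (gamma : R) (gamma_neq0 : gamma != 0) :
  [/\ 0 < gamma ->
        lie_isomorphic (L6 gamma) (h3 R * h3 R)%type
        /\ lie_decomposable (L6 gamma),
      gamma < 0 -> lie_isomorphic (L6 gamma) (L6 (- 1 : R))
    & 0 < gamma -> ~ lie_isomorphic (L6 gamma) (L6 (- 1 : R))].
Proof.
have e3_neq0 : (e_ 3 : h3 R) != 0.
  apply/eqP => /(congr1 (fun x : h3 R => coef x 3)).
  by rewrite coef_e_ // [RHS]mxE => /eqP; rewrite oner_eq0.
split=> [gamma_gt0 | gamma_lt0 | gamma_gt0 iso].
- have iso : lie_isomorphic (L6 gamma) (h3 R * h3 R)%type.
    rewrite -[gamma]Num.Theory.sqr_sqrtr ?Order.POrderTheory.ltW //.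
    apply: L6_square_iso; first by rewrite Num.Theory.pnatr_eq0.
    by rewrite Order.POrderTheory.gt_eqF // Num.Theory.sqrtr_gt0.
  by split=> //; exact: (lie_isomorphic_prod_decomposable e3_neq0 e3_neq0 iso).
- have -> : gamma = Num.sqrt (- gamma) ^+ 2 * -1.
    by rewrite Num.Theory.sqr_sqrtr ?mulrN1 ?opprK //; lra.
  apply: L6_scale_iso.
  by rewrite Order.POrderTheory.gt_eqF // Num.Theory.sqrtr_gt0; lra.
(* Since [gamma] is a square, an isomorphism would make [- 1] a square in [R]. *)
have /L6_rank_one_ad[t t2] : has_rank_one_ad (L6 (- 1 : R)).
  apply: (lie_isomorphic_rank_one_ad iso); apply/L6_rank_one_ad.
  exists (Num.sqrt gamma).
  by rewrite Num.Theory.sqr_sqrtr ?Order.POrderTheory.ltW.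
by have := Num.Theory.sqr_ge0 t; rewrite -t2; lra.
Qed.
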